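(* There exists a $[3,3,3]$-partite graph $G$, with a given $[3,3,3]$-partition $P$ of its vertex set, such that $G$ has no independent covering with respect to $P$. In particular, $c(3,3)\neq 3$.
   Context: A graph is $[n,k,r]$-partite if its vertex set can be partitioned into $n$ independent sets (vertex classes) of size $k$ such that between every pair of these independent sets the edges form exactly $r$ pairwise disjoint (independent) edges, and there are no other edges; such a partition is an $[n,k,r]$-partition. Given a partition $P$ of the vertex set, an independent transversal with respect to $P$ is an independent set containing exactly one vertex from each class of $P$; an independent covering with respect to $P$ is a collection of pairwise disjoint independent transversals with respect to $P$ whose union is the whole vertex set. $c(k,r)$ denotes the maximal $n$ such that every $[n,k,r]$-partite graph has an independent covering with respect to its given $[n,k,r]$-partition. *)

(* Defs.v *)
From HB Require Import structures.
From mathcomp Require Import all_boot.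

Set Implicit Arguments.
Unset Strict Implicit.
Unset Printing Implicit Defensive.

Record sgraph := SGraph {
  vertex :> finType;
  adj : rel vertex;
  adj_sym : symmetric adj;
  adj_irrefl : irreflexive adj
}.

Definition independent (G : sgraph) (S : {set G}) : bool :=
  [forall x in S, forall y in S, ~~ adj x y].

Definition edges_between (G : sgraph) (A B : {set G}) : {set {set G}} :=
  [set [set x; y] | x in A, y in B & adj x y].

(* "No other edges" needs no clause of its own: classes are independent, so   *)
(* every edge joins two distinct classes.                                     *)
Definition nkr_partition (n k r : nat) (G : sgraph) (P : {set {set G}}) : Prop :=
  [/\ partition P [set: G],
      #|P| = n,
      forall A, A \in P -> #|A| = k /\ independent A &
      forall A B, A \in P -> B \in P -> A != B ->
        #|edges_between A B| = r /\ trivIset (edges_between A B)].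

Definition independent_transversal (G : sgraph) (P : {set {set G}})
    (S : {set G}) : bool :=
  independent S && is_transversal S P [set: G].

Definition independent_covering (G : sgraph) (P C : {set {set G}}) : Prop :=
  [/\ forall S, S \in C -> independent_transversal P S,
      trivIset C &
      cover C = [set: G]].

Definition has_independent_covering (G : sgraph) (P : {set {set G}}) : Prop :=
  exists C : {set {set G}}, independent_covering P C.

Definition always_covered (n k r : nat) : Prop :=
  forall (G : sgraph) (P : {set {set G}}),
    nkr_partition n k r P -> has_independent_covering P.

(* "c(k,r) = n", as a relation because the maximum does not exist for every   *)
(* k and r: there is none when r = 0, for instance.                           *)
Definition is_c (k r n : nat) : Prop :=
  always_covered n k r /\ (forall m, always_covered m k r -> m <= n).

Lemma is_c_unique (k r m n : nat) : is_c k r m -> is_c k r n -> m = n.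
Proof.
by move=> [cm maxm] [cn maxn]; apply/eqP; rewrite eqn_leq maxn ?maxm.
Qed.

(* Main.v *)
Require Import Defs.
From HB Require Import structures.
From mathcomp Require Import all_boot.

Set Implicit Arguments.
Unset Strict Implicit.
Unset Printing Implicit Defensive.

(** The value is c(3,3) = 2.  Join n >= 3 classes of size 3 by the identity
    matchings, except that classes 0 and 1 are joined by a transposition.  A
    covering, read along class 2, makes its traces on classes 0 and 1
    derangements f and g of three letters, that is, rotations; then g o f^-1 is
    a rotation as well, and a rotation of three letters always agrees with a
    transposition somewhere.  For two classes joined by a perfect matching, a
    cyclic shift of the matching is a covering. *)

(** * The twisted graph and its columns *)

(** Two indices sum to 1 exactly when they are 0 and 1, in either order, so the test is symmetric in
    [i] and [j]. On three letters [rev_ord] is the transposition of 0 and 2. *)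
Definition twist (n : nat) (i j : 'I_n) (a : 'I_3) : 'I_3 :=
  if i + j == 1 then rev_ord a else a.

Lemma twistC (n : nat) (i j : 'I_n) : twist i j = twist j i.
Proof. by rewrite /twist addnC. Qed.

Lemma twistK (n : nat) (i j : 'I_n) : involutive (twist i j).
Proof. by move=> a; rewrite /twist; case: (_ == 1) => //; rewrite rev_ordK. Qed.

Definition twisted_adj (n : nat) : rel ('I_n * 'I_3) :=
  fun u v => (u.1 != v.1) && (v.2 == twist u.1 v.1 u.2).

Lemma twisted_adj_sym (n : nat) : symmetric (@twisted_adj n).
Proof.
move=> u v; rewrite /twisted_adj eq_sym (twistC v.1); congr (_ && _).
by rewrite eq_sym (inv_eq (twistK _ _)).
Qed.

Lemma twisted_adj_irrefl (n : nat) : irreflexive (@twisted_adj n).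
Proof. by move=> u; rewrite /twisted_adj eqxx. Qed.

Definition twisted (n : nat) : sgraph :=
  SGraph (@twisted_adj_sym n) (@twisted_adj_irrefl n).

Definition column (n : nat) (i : 'I_n) : {set twisted n} := [set u | u.1 == i].

Definition columns (n : nat) : {set {set twisted n}} :=
  [set column i | i : 'I_n].

Lemma column_imset (n : nat) (i : 'I_n) :
  column i = [set ((i, a) : twisted n) | a : 'I_3].
Proof.
apply/setP=> -[j a]; rewrite inE /=; apply/eqP/imsetP => [->|[b _ [-> _]] //].
by exists a.
Qed.

Lemma card_column (n : nat) (i : 'I_n) : #|column i| = 3.
Proof. by rewrite column_imset card_imset ?card_ord // => a b []. Qed.

Lemma column_inj (n : nat) : injective (@column n).
Proof.
move=> i j /setP/(_ (i, ord0)); rewrite !inE /= eqxx.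
by move/esym/eqP.
Qed.

Lemma columns_partition (n : nat) : partition (columns n) [set: twisted n].
Proof.
apply/and3P; split.
- apply/eqP/setP=> u; rewrite inE; apply/bigcupP; exists (column u.1).
    exact: imset_f.
  by rewrite inE.
- apply/trivIsetP=> _ _ /imsetP[i _ ->] /imsetP[j _ ->] neq.
  apply/pred0P=> u /=; rewrite !inE; apply/negP=> /andP[/eqP ui /eqP uj].
  by rewrite -ui -uj eqxx in neq.
- apply/imsetP=> -[i _ eq0]; have := card_column i.
  by rewrite -eq0 cards0.
Qed.

Definition rung (n : nat) (i j : 'I_n) (a : 'I_3) : {set twisted n} :=
  [set (i, a); (j, twist i j a)].

Lemma rung_disjoint (n : nat) (i j : 'I_n) (a b : 'I_3) :
  i != j -> a != b -> [disjoint rung i j a & rung i j b].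
Proof.
move=> neij neab; apply/pred0P=> u /=; rewrite !inE; apply/negP.
case/andP=> /orP[]/eqP-> /orP[]; rewrite xpair_eqE.
- by rewrite (negPf neab) andbF.
- by rewrite (negPf neij).
- by rewrite eq_sym (negPf neij).
- by rewrite (can_eq (twistK i j)) (negPf neab) andbF.
Qed.

Lemma edges_between_columns (n : nat) (i j : 'I_n) : i != j ->
  edges_between (column i) (column j) = [set rung i j a | a : 'I_3].
Proof.
move=> neij; apply/setP=> e; apply/imset2P/imsetP.
- case=> -[i' a] [j' b]; rewrite !inE /= => /eqP-> /andP[/eqP-> ].
  by rewrite /twisted_adj /= neij => /eqP-> ->; exists a.
- case=> a _ ->; exists (i, a) (j, twist i j a); rewrite ?inE //=.
  by rewrite /twisted_adj /= neij !eqxx.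
Qed.

Lemma twisted_nkr (n : nat) : nkr_partition n 3 3 (columns n).
Proof.
split; first exact: columns_partition.
- by rewrite card_imset ?card_ord //; apply: column_inj.
- move=> _ /imsetP[i _ ->]; split; first exact: card_column.
  apply/forall_inP=> u; rewrite inE => /eqP ui.
  apply/forall_inP=> v; rewrite inE => /eqP vi.
  by rewrite /= /twisted_adj ui vi eqxx.
- move=> _ _ /imsetP[i _ ->] /imsetP[j _ ->].
  rewrite (inj_eq (@column_inj n)) => neij.
  rewrite edges_between_columns //; split.
  (* Equal rungs with distinct indices would be disjoint, yet both contain [(i, a)]. *)
  + rewrite card_imset ?card_ord // => a b eqab; apply/eqP/negP => /negP neab.
    have /pred0P/(_ (i, a)) := rung_disjoint neij neab.
    by rewrite /= -eqab !inE eqxx.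
  + apply/trivIsetP=> _ _ /imsetP[a _ ->] /imsetP[b _ ->] neab.
    by apply: rung_disjoint => //; apply: contraNneq neab => ->.
Qed.

(** * Derangements of three letters *)

(** Both maps are rotations, so the inverse of [g] followed by [f] and then [rev_ord] is an odd
    permutation of three letters; it has a fixed point, which is the required [g a]. *)
Lemma derangements_agree_rev_ord (f g : 'I_3 -> 'I_3) :
  injective f -> injective g -> (forall a, f a != a) -> (forall a, g a != a) ->
  exists a, g a = rev_ord (f a).
Proof.
move=> injf injg derf derg.
suff /existsP[a /eqP ga] : [exists a, g a == rev_ord (f a)] by exists a.
have neq (h : 'I_3 -> 'I_3) a b : injective h -> a != b -> h a != h b.
  by move=> injh; rewrite (inj_eq injh).
pose o0 : 'I_3 := @Ordinal 3 0 isT; pose o1 : 'I_3 := @Ordinal 3 1 isT.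
pose o2 : 'I_3 := @Ordinal 3 2 isT.
apply: contraT; rewrite negb_exists => /forallP nag.
move: (nag o0) (nag o1) (nag o2) (derf o0) (derf o1) (derf o2)
  (derg o0) (derg o1) (derg o2).
(* Injectivity enters as three inequalities for each map, which leaves a finite check on six
   values. *)
move: (neq f o0 o1 injf isT) (neq f o0 o2 injf isT) (neq f o1 o2 injf isT).
move: (neq g o0 o1 injg isT) (neq g o0 o2 injg isT) (neq g o1 o2 injg isT).
rewrite -!val_eqE /=.
case: (f o0) (f o1) (f o2) => [[|[|[|//]]] ?] [[|[|[|//]]] ?] [[|[|[|//]]] ?] //;
by case: (g o0) (g o1) (g o2) => [[|[|[|//]]] ?] [[|[|[|//]]] ?] [[|[|[|//]]] ?].
Qed.

(** * Coverings of the twisted graph *)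

Lemma transversal_meets_column (n : nat) (S : {set twisted n}) (i : 'I_n) :
  independent_transversal (columns n) S -> exists a, (i, a) \in S.
Proof.
case/andP=> _ /and3P[_ _ /forall_inP/(_ (column i) (imset_f _ isT))].
case/cards1P=> -[j a] /setP/(_ (j, a)); rewrite !inE /= eqxx.
by case/andP=> Sja /eqP <-; exists a.
Qed.

Lemma transversal_column_inj (n : nat) (S : {set twisted n}) (i : 'I_n) a b :
  independent_transversal (columns n) S -> (i, a) \in S -> (i, b) \in S -> a = b.
Proof.
case/andP=> _ /and3P[_ _ /forall_inP/(_ (column i) (imset_f _ isT))].
case/cards1P=> u /setP eqS Sa Sb.
have := eqS (i, a); have := eqS (i, b).
by rewrite !inE Sa Sb /= eqxx => /esym/eqP <- /esym/eqP[].
Qed.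

Lemma twisted_no_covering (n : nat) :
  ~ has_independent_covering (columns n.+3).
Proof.
case=> C [trC triv covC].
pose i0 : 'I_n.+3 := @Ordinal n.+3 0 isT.
pose i1 : 'I_n.+3 := @Ordinal n.+3 1 isT.
pose i2 : 'I_n.+3 := @Ordinal n.+3 2 isT.
(* [S a] is the transversal of the covering through letter [a] of column 2. *)
pose S a : {set twisted n.+3} := pblock C (i2, a).
have covS a : (i2, a) \in cover C by rewrite covC inE.
have CS a : S a \in C by apply: pblock_mem.
have trS a : independent_transversal (columns n.+3) (S a) by apply: trC.
have [f Sf] := fin_all_exists (fun a => transversal_meets_column i0 (trS a)).
have [g Sg] := fin_all_exists (fun a => transversal_meets_column i1 (trS a)).
have Sinj a b : S a = S b -> a = b.
  move=> eqS; apply: (@transversal_column_inj _ (S a) i2) => //.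
    by rewrite mem_pblock.
  by rewrite eqS mem_pblock.
(* Members of [C] that share a vertex coincide, so distinct letters have distinct traces on each
   column. *)
have trace_inj (i : 'I_n.+3) (h : 'I_3 -> 'I_3) :
    (forall a, (i, h a) \in S a) -> injective h.
  move=> Sh a b eqh; apply: Sinj.
  rewrite -(def_pblock triv (CS a) (Sh a)) eqh.
  exact: (def_pblock triv (CS b) (Sh b)).
have indS a u v : u \in S a -> v \in S a -> ~~ twisted_adj u v.
  by case/andP: (trS a) => /forall_inP ind _ Su /(forall_inP (ind u Su)).
have [injf injg] := (trace_inj _ _ Sf, trace_inj _ _ Sg).
(* Column 2 is joined to columns 0 and 1 by identity matchings, so a fixed point of [f] or [g] would
   give an edge inside [S a]. The agreement [ga] gives one between columns 0 and 1. *)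
have [a|a|a ga] := derangements_agree_rev_ord injf injg.
- have := indS a _ _ (Sf a) (etrans (mem_pblock _ _) (covS a)).
  by rewrite /twisted_adj /twist /= eq_sym.
- have := indS a _ _ (Sg a) (etrans (mem_pblock _ _) (covS a)).
  by rewrite /twisted_adj /twist /= eq_sym.
- by have := indS a _ _ (Sf a) (Sg a); rewrite /twisted_adj /twist /= ga eqxx.
Qed.

(** * Perfect matchings between two classes *)

(** The [k] disjoint edges have [2k] ends in all, as many as [A :|: B] has vertices. *)
Lemma edges_between_cover (G : sgraph) (A B : {set G}) (k : nat) :
  [disjoint A & B] -> #|A| = k -> #|B| = k ->
  #|edges_between A B| = k -> trivIset (edges_between A B) ->
  cover (edges_between A B) = A :|: B.
Proof.
move=> disAB cA cB cE triv; apply/eqP; rewrite eqEcard; apply/andP; split.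
  apply/bigcupsP=> _ /imset2P[x y Ax /[1!inE]/andP[By _] ->].
  by apply/subsetP=> z /set2P[]->; rewrite inE ?Ax ?By ?orbT.
rewrite cardsU (disjoint_setI0 disAB) cards0 subn0 cA cB.
move: triv; rewrite /trivIset => /eqP <-.
rewrite (eq_bigr (fun=> 2)) ?sum_nat_const ?cE; first by rewrite muln2 addnn.
move=> _ /imset2P[x y Ax /[1!inE]/andP[By _] ->]; rewrite cards2; case: eqP => // exy.
by have := disjointFr disAB Ax; rewrite exy By.
Qed.

(** Each vertex of [A] lies on an edge because the edges cover, and on only one because they are
    disjoint. The same uniqueness seen from [B] makes the partner map injective. *)
Lemma perfect_matching_partner (G : sgraph) (A B : {set G}) (k : nat) :
  [disjoint A & B] -> #|A| = k -> #|B| = k ->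
  #|edges_between A B| = k -> trivIset (edges_between A B) ->
  exists f : G -> G,
    [/\ f @: A = B, {in A &, injective f} &
        forall x y, x \in A -> y \in B -> adj x y -> y = f x].
Proof.
move=> disAB cA cB cE triv.
have cov := edges_between_cover disAB cA cB cE triv.
have neAB x y : x \in A -> y \in B -> x == y = false.
  by move=> Ax By; apply: contraTF By => /eqP <-; rewrite (disjointFr disAB).
have edge x y : x \in A -> y \in B -> adj x y ->
    [set x; y] \in edges_between A B.
  by move=> Ax By xy; apply/imset2P; exists x y; rewrite ?inE ?By.
have same e1 e2 z : e1 \in edges_between A B -> e2 \in edges_between A B ->
    z \in e1 -> z \in e2 -> e1 = e2.
  move=> E1 E2 z1 z2.
  by rewrite -(def_pblock triv E1 z1); apply: def_pblock.
have uniq2 x y z : x \in A -> y \in B -> z \in B -> adj x y -> adj x z -> y = z.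
  move=> Ax By Bz xy xz.
  have := same _ _ x (edge _ _ Ax By xy) (edge _ _ Ax Bz xz).
  rewrite !inE eqxx => /(_ isT isT)/setP/(_ y).
  by rewrite !inE eqxx orbT eq_sym neAB //= => /esym/eqP.
have uniq1 x y z : x \in A -> y \in A -> z \in B -> adj x z -> adj y z -> x = y.
  move=> Ax Ay Bz xz yz.
  have := same _ _ z (edge _ _ Ax Bz xz) (edge _ _ Ay Bz yz).
  rewrite !inE eqxx !orbT => /(_ isT isT)/setP/(_ x).
  by rewrite !inE eqxx (neAB x z) // !orbF => /esym/eqP.
(* The premise sits under the existential so that a total function can be chosen; off [A] the
   witness [x] is arbitrary. *)
have ex x : exists y, x \in A -> (y \in B) && adj x y.
  case Ax: (x \in A); last by exists x.
  have : x \in cover (edges_between A B) by rewrite cov inE Ax.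
  case/bigcupP=> _ /imset2P[x' y Ax' ByX ->] /set2P[->|exy].
    by exists y; move: ByX; rewrite inE => ->.
  move: ByX; rewrite inE => /andP[By _].
  by have := neAB _ _ Ax By; rewrite exy eqxx.
have [f fP] := fin_all_exists ex.
have finj : {in A &, injective f}.
  move=> x y Ax Ay eqf; case/andP: (fP x Ax) => Bx xfx.
  by case/andP: (fP y Ay) => _; rewrite -eqf; apply: uniq1.
exists f; split=> //.
(* An injective image of [A] inside [B] fills it, as both have [k] elements. *)
- apply/eqP; rewrite eqEcard (card_in_imset finj) cA cB leqnn andbT.
  by apply/subsetP=> _ /imsetP[x Ax ->]; case/andP: (fP x Ax).
- by move=> x y Ax By xy; case/andP: (fP x Ax) => Bf xf; apply: (uniq2 x).
Qed.

(** * The covering by a cyclic shift *)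

(** After a rotation [x] heads the list and its successor is the second entry, which differs from
    [x] by [uniq]. *)
Lemma next_neq (T : eqType) (s : seq T) (x : T) :
  uniq s -> 1 < size s -> x \in s -> next s x != x.
Proof.
move=> us s2 /rot_to[i [|y t] rots]; move: s2.
  by rewrite -(size_rot i) rots.
rewrite -(next_rot i us) rots /= eqxx => _.
by move: us; rewrite -(rot_uniq i) rots /= inE negb_or eq_sym => /andP[/andP[]].
Qed.

(** With [s] a cyclic shift of [A] and [f] the matching, the pairs of [x] and [f (s x)] form a
    covering; [1 < k] keeps [s] free of fixed points on [A]. *)
Lemma always_covered_two (k : nat) : 1 < k -> always_covered 2 k k.
Proof.
move=> k_gt1 G P [partP cP classP pairP].
have [covP trivP _] := and3P partP.
move/eqP/cards2P: cP => [A [B [neAB defP]]].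
have PA : A \in P by rewrite defP !inE eqxx.
have PB : B \in P by rewrite defP !inE eqxx orbT.
have [cA _] := classP A PA; have [cB _] := classP B PB.
have [cE trivE] := pairP A B PA PB neAB.
have disAB : [disjoint A & B] by apply: (trivIsetP trivP).
have [f [fA finj fP]] := perfect_matching_partner disAB cA cB cE trivE.
pose s x := next (enum A) x.
have sA x : x \in A -> s x \in A.
  by rewrite -!(mem_enum A) mem_next.
(* Off the list [next] is the identity, so [s] is injective on all vertices. *)
have sinj : injective s by apply: can_inj (prev_next (enum_uniq A)).
have sneq x : x \in A -> s x != x.
  by move=> Ax; rewrite next_neq ?enum_uniq ?mem_enum // -cardE cA.
have fB x : x \in A -> f x \in B by rewrite -fA; apply: imset_f.
have notB x : x \in A -> (x \in B) = false by apply: disjointFr.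
have neq x y : x \in A -> y \in B -> x == y = false.
  by move=> Ax By; apply: contraTF By => /eqP <-; rewrite notB.
exists [set [set x; f (s x)] | x in A]; split.
- move=> _ /imsetP[x Ax ->]; have Asx := sA x Ax; have Bfsx := fB _ Asx.
  (* An edge from [x] to [B] ends in [f x], so adjacency would force [s x = x]. *)
  have nadj : ~~ adj x (f (s x)).
    apply: contraNN (sneq x Ax) => xfs; apply/eqP/finj => //.
    exact: fP.
  apply/andP; split.
    apply/forall_inP=> u /set2P[]->; apply/forall_inP=> v /set2P[]->;
    by rewrite ?adj_irrefl // adj_sym.
  apply/and3P; split=> //.
  apply/forall_inP=> D; rewrite defP => /set2P[]->; apply/cards1P.
    exists x; apply/setP=> z; rewrite !inE.
    case: (eqVneq z x) => [->|_] //=; case: (eqVneq z) => //= ->.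
    by rewrite (disjointFl disAB).
  exists (f (s x)); apply/setP=> z; rewrite !inE.
  case: (eqVneq z x) => [->|_] /=; first by rewrite notB ?neq.
  by case: (eqVneq z) => //= ->.
- apply/trivIsetP=> _ _ /imsetP[x Ax ->] /imsetP[y Ay ->] nexy.
  have {}nexy : x == y = false by apply: contraNF nexy => /eqP->.
  have [Bx By] := (fB _ (sA x Ax), fB _ (sA y Ay)).
  apply/pred0P=> z /=; rewrite !inE; apply/negP.
  case/andP=> /orP[]/eqP-> /orP[].
  + by rewrite nexy.
  + by rewrite neq.
  + by rewrite eq_sym neq.
  + by move/eqP/finj => /(_ (sA x Ax) (sA y Ay))/sinj/eqP; rewrite nexy.
(* Since [s] permutes [A] and [f] maps [A] onto [B], the second ends exhaust [B]. *)
- have sAA : s @: A = A.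
    apply/eqP; rewrite eqEcard (card_imset _ sinj) leqnn andbT.
    by apply/subsetP=> _ /imsetP[x Ax ->]; apply: sA.
  apply/setP=> z; rewrite -(eqP covP) defP.
  rewrite [cover [set A; B]]/cover bigcup_setU !big_set1 inE.
  apply/bigcupP/orP => [[_ /imsetP[x Ax ->] /set2P[]->]|[Az|]].
  + by left.
  + by right; apply/fB/sA.
  + by exists [set z; f (s z)]; [exact: imset_f | rewrite !inE eqxx].
  + rewrite -fA -{1}sAA => /imsetP[_ /imsetP[x Ax ->] ->].
    by exists [set x; f (s x)]; [exact: imset_f | rewrite !inE eqxx orbT].
Qed.

Theorem theorem1 :
  (exists (G : sgraph) (P : {set {set G}}),
     nkr_partition 3 3 3 P /\ ~ has_independent_covering P) /\
  (exists2 c : nat, is_c 3 3 c & c <> 3).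
Proof.
split.
  exists (twisted 3), (columns 3).
  by split; [exact: twisted_nkr | exact: twisted_no_covering].
exists 2 => //; split; first exact: always_covered_two.
(* The values 0, 1 and 2 satisfy the bound outright; from three classes on, the twisted graph
   refutes [covm]. *)
move=> [|[|[|m]]] // covm.
by have := @twisted_no_covering m (covm _ _ (twisted_nkr _)).
Qed.
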